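(* Let $G$ be a finite simple bipartite graph with bipartition $(X,Y)$, on $n$ vertices, with biclique number $t$. Then $\varphi(G)\leq \left\lfloor \frac{n-t+4}{2}\right\rfloor$.
   Context: A biclique of $G$ is a subgraph of $G$ that is a complete bipartite graph (a single vertex being regarded as a complete bipartite graph with one side empty). The biclique number of $G$ is the minimum number of mutually vertex-disjoint bicliques of $G$ covering all vertices of $G$. A $b$-coloring of $G$ with $b$ colors is a proper coloring of $V(G)$ using exactly $b$ colors such that for every color $i$ there is a vertex of color $i$ having neighbors of all the other $b-1$ colors. The $b$-chromatic number $\varphi(G)$ is the largest $b$ for which such a coloring exists. *)

(* Defs.v *)
From mathcomp Require Import all_boot.

Set Implicit Arguments.
Unset Strict Implicit.
Unset Printing Implicit Defensive.

(* A finite simple graph on V is a symmetric irreflexive e : rel V; these two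
   properties are hypotheses of the results about e. *)

Section Graph.
Variables (V : finType) (e : rel V).

(* X or Y may be empty. *)
Definition bipartition (X Y : {set V}) : bool :=
  [&& [disjoint X & Y], X :|: Y == [set: V] &
      [forall x, forall y, e x y ==>
         (x \in X) && (y \in Y) || (x \in Y) && (y \in X)]].

(* S is the vertex set of a complete bipartite subgraph (A and B are its sides,
   and the subgraph need not be induced).  Both sides are nonempty except in
   the one-vertex case, so an independent set with two or more vertices is not
   a biclique. *)
Definition biclique (S : {set V}) : bool :=
  (#|S| == 1) ||
  [exists A : {set V}, exists B : {set V},
     [&& A != set0, B != set0, [disjoint A & B], A :|: B == S &
         [forall x in A, forall y in B, e x y]]].

(* Vertex-disjoint bicliques have distinct nonempty vertex sets, so a cover by
   them can be represented, and counted, as a partition of the vertex set. *)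
Definition biclique_cover (P : {set {set V}}) : bool :=
  partition P [set: V] && [forall S in P, biclique S].

Definition singletons : {set {set V}} := [set [set x] | x : V].

Lemma singletons_cover : biclique_cover singletons.
Proof.
apply/andP; split; last first.
  by apply/forall_inP => S /imsetP[x _ ->]; rewrite /biclique cards1.
apply/and3P; split.
- apply/eqP/setP => x; rewrite inE; apply/bigcupP.
  by exists [set x]; [apply: imset_f | rewrite inE].
- apply/trivIsetP => A B /imsetP[x _ ->] /imsetP[y _ ->] neq_xy.
  rewrite disjoints1 inE; apply: contra neq_xy => /eqP->.
  exact: eqxx.
- by apply/imsetP => -[x _ /setP/(_ x)]; rewrite !inE eqxx.
Qed.

Definition biclique_number : nat :=
  #|[arg min_(P < singletons | biclique_cover P) #|P|]|.

Lemma biclique_numberP :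
  (exists2 P, biclique_cover P & #|P| = biclique_number) /\
  (forall P, biclique_cover P -> biclique_number <= #|P|).
Proof.
rewrite /biclique_number; case: arg_minnP; first exact: singletons_cover.
by move=> P coverP minP; split => //; exists P.
Qed.

Definition b_coloring (b : nat) (c : {ffun V -> 'I_b}) : bool :=
  [&& [forall x, forall y, e x y ==> (c x != c y)],
      [forall i, exists x, c x == i] &
      [forall i, exists v, (c v == i) &&
         [forall j, (j != i) ==> [exists w, e v w && (c w == j)]]]].

Definition b_colorable (b : nat) : bool :=
  [exists c : {ffun V -> 'I_b}, b_coloring c].

Lemma b_colorable_card (b : nat) : b_colorable b -> b <= #|V|.
Proof.
case/existsP => c /and3P[_ /forallP c_surj _].
rewrite -[b]card_ord -(@card_codom _ _ (fun i : 'I_b => xchoose (existsP (c_surj i)))).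
  exact: max_card.
move=> i j eq_ij.
by rewrite -(eqP (xchooseP (existsP (c_surj i)))) eq_ij
           (eqP (xchooseP (existsP (c_surj j)))).
Qed.

(* The range loses nothing, by b_colorable_card. *)
Definition b_chromatic_number : nat :=
  \max_(b < #|V|.+1 | b_colorable b) b.

Lemma b_chromatic_number_max (b : nat) :
  b_colorable b -> b <= b_chromatic_number.
Proof.
move=> col_b; have lt_b : b < #|V|.+1 by rewrite ltnS b_colorable_card.
exact: (@leq_bigmax_cond _ (fun i : 'I_#|V|.+1 => b_colorable i)
          (fun i => nat_of_ord i) (Ordinal lt_b)).
Qed.

End Graph.

(* Main.v *)
Require Import Defs.
From mathcomp Require Import all_boot.
From mathcomp Require Import zify.

(** The complement of a dominating set [D] can be distributed into stars
    centred at [D], so the biclique number is at most the domination number.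
    In a [b]-coloring every color has a vertex of degree at least [b - 1].  If
    both sides of the bipartition contain a vertex of degree at least [b - 1],
    the stars at two such vertices save [2(b - 2)] bicliques over the singletons.
    Otherwise all the chosen vertices [v_i] lie on one side; a color seen only
    once among their neighbors would sit at a vertex adjacent to [b - 1] of the
    [v_i] on the other side, so every color is seen at least twice, and the
    stars at the [v_i] save at least [2b] bicliques. *)

Set Implicit Arguments.
Unset Strict Implicit.
Unset Printing Implicit Defensive.

Section Bicliques.

Variables (V : finType) (e : rel V).
Hypothesis e_sym : symmetric e.

Lemma biclique_star (a : V) (S : {set V}) :
  a \in S -> {in S :\ a, forall y, e a y} -> biclique e S.
Proof.
move=> aS aE; rewrite /biclique.
case: (eqVneq (S :\ a) set0) => [S0|S_n0].
  by rewrite (cardsD1 a) aS S0 cards0.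
apply/orP; right; apply/existsP; exists [set a]; apply/existsP; exists (S :\ a).
rewrite S_n0 setD1K // eqxx disjoints1 setD11 -card_gt0 cards1 /=.
by apply/forall_inP => x /set1P ->; apply/forall_inP.
Qed.

Lemma biclique_number_dominating (D : {set V}) :
  (forall x, x \notin D -> exists2 y, y \in D & e x y) ->
  biclique_number e <= #|D|.
Proof.
move=> domD.
(* [f] assigns to each vertex the centre of its star. Vertices of [D] choose themselves, so each
   fibre over [d] in [D] contains [d] and otherwise only neighbours of [d]. *)
have [f fP] : exists f : V -> V, forall x,
    f x \in D /\ (if x \in D then f x == x else e x (f x)).
  apply: (@fin_all_exists V (fun=> V) (fun x y =>
    y \in D /\ (if x \in D then y == x else e x y))) => x.
  have [xD|xD] := boolP (x \in D); first by exists x.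
  by have [y yD exy] := domD x xD; exists y.
pose P := preim_partition f [set: V].
have subP : P \subset [set f @^-1: [set d] | d in D].
  apply/subsetP => _ /imsetP[x _ ->]; apply/imsetP; exists (f x).
    by case: (fP x).
  by apply/setP => y; rewrite !inE eq_sym.
have [_ minP] := biclique_numberP e.
apply: leq_trans (minP P _) _; last first.
  exact: leq_trans (subset_leq_card subP) (leq_imset_card _ _).
rewrite /biclique_cover preim_partitionP /=.
apply/forall_inP => _ /(subsetP subP)/imsetP[d dD ->].
apply: (@biclique_star d).
  by case: (fP d) => _; rewrite dD !inE.
move=> y; rewrite !inE => /andP[y_d /eqP fy].
case: (fP y) => _; rewrite fy; case: ifP => _; last by rewrite e_sym.
by rewrite eq_sym (negPf y_d).
Qed.

(** Here [D] is the set of leaves and its complement dominates: each leaf absorbed into a star saves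
    one biclique over the cover by singletons. *)
Lemma biclique_number_codominating (D : {set V}) :
  {in D, forall x, exists2 y, y \notin D & e x y} ->
  biclique_number e + #|D| <= #|V|.
Proof.
move=> domD; rewrite -(cardsC D) addnC leq_add2l.
apply: biclique_number_dominating => x; rewrite inE negbK => /domD[y yD exy].
by exists y; rewrite ?inE.
Qed.

Lemma bipartitionC (X Y : {set V}) : bipartition e X Y -> bipartition e Y X.
Proof.
case/and3P=> dXY /eqP covXY /forallP edges.
rewrite /bipartition disjoint_sym dXY setUC covXY eqxx /=.
apply/forallP => x; apply/forallP => y; apply/implyP => exy.
by have := forallP (edges x) y; rewrite exy orbC.
Qed.

Lemma bipartition_edge (X Y : {set V}) x y :
  bipartition e X Y -> e x y -> x \in X -> (y \in Y) && (y \notin X).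
Proof.
case/and3P=> dXY _ /forallP edges exy xX.
have := forallP (edges x) y; rewrite exy xX (disjointFr dXY xX) /= orbF => yY.
by rewrite yY (disjointFl dXY yY).
Qed.

(** The two neighbourhoods lie on opposite sides, so no leaf is counted twice. If [x] and [y] are
    adjacent, each must be removed from the leaves of the other to remain a centre; the strict
    bounds on the degrees pay for this loss. *)
Lemma biclique_number_two_stars (X Y : {set V}) (k : nat) (x y : V) :
  bipartition e X Y -> x \in X -> y \in Y ->
  k < #|[set z | e x z]| -> k < #|[set z | e y z]| ->
  biclique_number e + k.*2 <= #|V|.
Proof.
move=> bip xX yY degx degy.
have nbx z : e x z -> (z \in Y) && (z \notin X).
  by move=> exz; apply: (bipartition_edge bip exz xX).
have nby z : e y z -> (z \in X) && (z \notin Y).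
  by move=> eyz; apply: (bipartition_edge (bipartitionC bip) eyz yY).
have xY : x \notin Y.
  by case/and3P: bip => dXY _ _; rewrite (disjointFr dXY xX).
have yX : y \notin X.
  by case/and3P: bip => dXY _ _; rewrite (disjointFl dXY yY).
pose A := [set z | e x z] :\ y; pose B := [set z | e y z] :\ x.
have disjAB : A :&: B = set0.
  apply/setP => z; rewrite !inE; apply/negP.
  case/andP=> /andP[_ /nbx/andP[zY _]] /andP[_ /nby/andP[_]].
  by rewrite zY.
have cardAB : k.*2 <= #|A :|: B|.
  rewrite cardsU disjAB cards0 subn0 -addnn.
  move: degx degy; rewrite (cardsD1 y) [in X in _ -> X](cardsD1 x) -/A -/B.
  by lia.
apply: leq_trans (biclique_number_codominating (D := A :|: B) _).
  by rewrite leq_add2l.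
have xAB : x \notin A :|: B.
  rewrite !inE eqxx /= orbF; apply/negP => /andP[_ /nbx].
  by rewrite (negPf xY).
have yAB : y \notin A :|: B.
  rewrite !inE eqxx /=; apply/negP => /andP[_ /nby].
  by rewrite (negPf yX).
move=> z; rewrite !inE => /orP[] /andP[_ ez]; [exists x | exists y] => //.
  by rewrite e_sym.
by rewrite e_sym.
Qed.

Section Coloring.

Variables (b : nat) (c : V -> 'I_b) (v : 'I_b -> V).
Hypothesis vK : cancel v c.
Hypothesis v_sees : forall i j, j != i -> exists2 w, e (v i) w & c w = j.

Lemma color_dominating_degree i : b.-1 <= #|[set z | e (v i) z]|.
Proof.
rewrite -[b in b.-1]card_ord -cardsT (cardsD1 i) inE /=.
apply: leq_trans (leq_imset_card c _); apply: subset_leq_card.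
apply/subsetP => j; rewrite !inE andbT => /v_sees[w ew <-].
by apply: imset_f; rewrite inE.
Qed.

Lemma biclique_number_one_sided (X Y : {set V}) :
  bipartition e X Y -> 2 < b -> (forall i, v i \in X) ->
  biclique_number e + b.*2 <= #|V| + 4.
Proof.
move=> bip b_gt2 vX.
pose N := [set w | [exists i, e (v i) w]].
have other j : exists i : 'I_b, j != i.
  suff: 0 < #|[set~ j]|.
    by case/card_gt0P=> i; rewrite !inE eq_sym => ji; exists i.
  by rewrite cardsC1 card_ord; lia.
have [/forallP twice|] :=
  boolP [forall j, 1 < #|[set w in N | c w == j]|].
  have NC : biclique_number e + #|N| <= #|V|.
    apply: biclique_number_codominating => w; rewrite inE => /existsP[i ew].
    exists (v i); last by rewrite e_sym.
    (* The centres stay outside [N]: they all lie in [X], whereas neighbours of vertices of [X] do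
       not. *)
    rewrite inE; apply/existsP => -[k /(bipartition_edge bip)/(_ (vX k))].
    by rewrite vX andbF.
  suff: b.*2 <= #|N| by lia.
  rewrite -[#|N|]sum1_card (partition_big c predT) //=.
  apply: (@leq_trans (\sum_(j < b) 2)).
    by rewrite sum_nat_const card_ord muln2.
  apply: leq_sum => j _; rewrite sum1_card.
  by apply: leq_trans (twice j) _; rewrite cardsE.
case/forallPn=> j; rewrite -leqNgt => once.
have [i ji] := other j.
have [y ey cy] := v_sees ji.
(* Every [v k] with [k != j] has a neighbour of color [j]. It lies in [N], where color [j] occurs at
   most once, so it is [y]. *)
have yE k : k != j -> e y (v k).
  move=> kj; have [w ew cw] : exists2 w, e (v k) w & c w = j.
    by apply: v_sees; rewrite eq_sym.
  suff -> : y = w by rewrite e_sym.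
  apply: (card_le1_eqP once); rewrite !inE ?cy ?cw eqxx andbT; apply/existsP.
    by exists k.
  by exists i.
have degy : b.-1 <= #|[set z | e y z]|.
  have -> : b.-1 = #|v @: [set~ j]|.
    by rewrite card_imset ?cardsC1 ?card_ord //; apply: can_inj vK.
  apply: subset_leq_card; apply/subsetP => _ /imsetP[k kj ->].
  by rewrite inE yE // -in_setC1.
have yY : y \in Y by case/andP: (bipartition_edge bip ey (vX i)).
have degi := color_dominating_degree i.
(* Both degrees are at least [b - 1], hence exceed [b - 2]; the saving [2(b - 2)] is the source of
   the constant 4. *)
have := @biclique_number_two_stars X Y b.-2 (v i) y bip (vX i) yY.
by lia.
Qed.

Lemma biclique_number_coloring (X Y : {set V}) :
  bipartition e X Y -> biclique_number e + b.*2 <= #|V| + 4.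
Proof.
move=> bip.
have t_le : biclique_number e <= #|V|.
  by rewrite -cardsT; apply: biclique_number_dominating => x; rewrite inE.
(* For [b <= 2] the term [2b] is at most 4, and [t_le] suffices. *)
have [b_le2|b_gt2] := leqP b 2; first by lia.
have XorY x : (x \in X) || (x \in Y).
  by case/and3P: bip => _ /eqP cov _; rewrite -in_setU cov inE.
have [/forallP|/forallPn[i iX]] := boolP [forall i, v i \in X].
  exact: biclique_number_one_sided bip b_gt2.
have [/forallP|/forallPn[j jY]] := boolP [forall j, v j \in Y].
  exact: biclique_number_one_sided (bipartitionC bip) b_gt2.
have viY : v i \in Y by have := XorY (v i); rewrite (negPf iX).
have vjX : v j \in X by have := XorY (v j); rewrite (negPf jY) orbF.
have degi := color_dominating_degree i.
have degj := color_dominating_degree j.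
have := @biclique_number_two_stars X Y b.-2 (v j) (v i) bip vjX viY.
by lia.
Qed.

End Coloring.

Lemma biclique_number_b_colorable (X Y : {set V}) (b : nat) :
  bipartition e X Y -> b_colorable e b ->
  biclique_number e + b.*2 <= #|V| + 4.
Proof.
move=> bip /existsP[c /and3P[_ _ /forallP dom]].
(* Choose for each color one vertex of that color that sees all the others. *)
have [v vP] := fin_all_exists (fun i => existsP (dom i)).
apply: (@biclique_number_coloring b c v _ _ X Y) => // [i|i j ji].
  by case/andP: (vP i) => /eqP.
case/andP: (vP i) => _ /forallP/(_ j); rewrite ji => /existsP[w /andP[ew /eqP cw]].
by exists w.
Qed.

End Bicliques.

Theorem theorem4 (V : finType) (e : rel V)
    (e_sym : symmetric e) (e_irr : irreflexive e)
    (X Y : {set V}) (XY_bip : bipartition e X Y)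
    (n t : nat) (n_def : #|V| = n) (t_def : biclique_number e = t) :
  b_chromatic_number e <= (n - t + 4) %/ 2.
Proof.
(* By this bound the truncated [n - t] is the true difference. *)
have t_le : biclique_number e <= #|V|.
  rewrite -cardsT; apply: biclique_number_dominating => // x.
  by rewrite inE.
apply/bigmax_leqP => b col_b.
have := biclique_number_b_colorable e_sym XY_bip col_b.
by lia.
Qed.
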